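(* For each $s \in \{5, 6, 7, 28\}$ there exists a continuous piecewise linear extreme function (for the single-row infinite group problem $R_f(\mathbb{R},\mathbb{Z})$, for some $f \in \mathbb{R}\setminus\mathbb{Z}$) with exactly $s$ slopes. Moreover, there exist discontinuous piecewise linear extreme functions with 3 slopes, and there exist discontinuous piecewise linear extreme functions that are discontinuous on both sides at the origin.
   Context: Fix $f\in\mathbb{R}\setminus\mathbb{Z}$. The single-row infinite group problem $R_f(\mathbb{R},\mathbb{Z})$ is the convex hull of the set of all finitely supported functions $y\colon\mathbb{R}\to\mathbb{Z}_+$ (with $\mathbb{Z}_+ = \{0,1,2,\dots\}$) such that $\sum_{r\in\mathbb{R}} r\,y(r)\in f+\mathbb{Z}$. A valid function for $R_f(\mathbb{R},\mathbb{Z})$ is a function $\pi\colon\mathbb{R}\to\mathbb{R}$ with $\pi\ge 0$ and $\sum_{r\in\mathbb{R}}\pi(r)y(r)\ge 1$ for all $y\in R_f(\mathbb{R},\mathbb{Z})$. A valid function $\pi$ is extreme if $\pi=\tfrac12(\pi^1+\pi^2)$ with $\pi^1,\pi^2$ valid functions for $R_f(\mathbb{R},\mathbb{Z})$ implies $\pi=\pi^1=\pi^2$. A function $\pi\colon\mathbb{R}\to\mathbb{R}$ is piecewise linear (not necessarily continuous) if $\mathbb{R}$ is a union of closed intervals with non-overlapping interiors such that any bounded subset of $\mathbb{R}$ meets only finitely many of them, and $\pi$ is affine linear over the interior of each interval. The number of slopes of a piecewise linear function is the number of different values that its derivative takes where the derivative exists. ''Discontinuous on both sides at the origin'' means that the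 function is neither continuous from the left nor continuous from the right at $0$. *)

(* Defs.v *)
From mathcomp Require Import all_boot all_order all_algebra.
From mathcomp Require Import all_classical all_reals all_analysis.

Set Implicit Arguments.
Unset Strict Implicit.
Unset Printing Implicit Defensive.

Import Order.TTheory GRing.Theory Num.Theory.
Import numFieldNormedType.Exports.

Local Open Scope classical_set_scope.
Local Open Scope ring_scope.

Definition finitely_supported (R : realType) (y : R -> R) : Prop :=
  finite_set [set r | y r != 0].

(* Z_+-valued functions are seen inside the vector space R -> R, where the
   convex hull is taken.  The sums \sum_(r \in setT) below are meaningful only
   for finite supports (they are 0 by convention otherwise). *)
Definition integer_solution (R : realType) (f : R) : set (R -> R) :=
  [set y | [/\ finitely_supported y,
              forall r, y r \is a Num.nat
            & \sum_(r \in [set: R]) r * y r - f \is a Num.int]].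

Definition convex_hull (R : realType) (M : lmodType R) (A : set M) : set M :=
  smallest (@convex_set R M) A.

Definition group_problem (R : realType) (f : R) : set (R -> R) :=
  @convex_hull R (R -> R) (integer_solution f).

Definition valid_function (R : realType) (f : R) (p : R -> R) : Prop :=
  (forall r, 0 <= p r) /\
  (forall y, group_problem f y -> 1 <= \sum_(r \in [set: R]) p r * y r).

Definition extreme_function (R : realType) (f : R) (p : R -> R) : Prop :=
  valid_function f p /\
  (forall p1 p2 : R -> R, valid_function f p1 -> valid_function f p2 ->
     (forall x, p x = 2^-1 * (p1 x + p2 x)) -> p = p1 /\ p = p2).

(* Closed intervals are the closed, order-convex subsets of R: compact
   intervals, closed rays and R itself.  Degenerate ones are not excluded; by
   local finiteness they do not affect the notion. *)
Definition piecewise_linear (R : realType) (p : R -> R) : Prop :=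
  exists C : set (set R),
    [/\ forall J, C J -> is_interval J /\ closed J,
        \bigcup_(J in C) J = [set: R],
        forall J K, C J -> C K -> J <> K -> J° `&` K° = set0,
        forall B : set R, bounded_set B ->
          finite_set [set J | C J /\ J `&` B !=set0]
      & forall J, C J -> exists a b : R, forall x, J° x -> p x = a * x + b].

Definition slopes (R : realType) (p : R -> R) : set R :=
  [set d | exists2 x, derivable p x 1 & d = derive1 p x].

Definition has_n_slopes (R : realType) (n : nat) (p : R -> R) : Prop :=
  (slopes p #= `I_n)%card.

Definition continuous_from_left (R : realType) (p : R -> R) (x : R) : Prop :=
  p t @[t --> x^'-] --> p x.

Definition continuous_from_right (R : realType) (p : R -> R) (x : R) : Prop :=
  p t @[t --> x^'+] --> p x.

(* Main.v *)
(* If p is valid and p = (p1 + p2) / 2 with p1, p2 valid, then every integer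
   solution that is tight for p is tight for p1 and p2.  When p is also
   symmetric, p x + p (f - x) = 1, each relation p (x + y) = p x + p y amounts
   to the tightness of the solution {x, y, f - x - y}, so p1 and p2 inherit all
   additive relations of p.  A bounded function that is additive on an interval
   is linear there, and for the functions below this forces p1 = p2 = p.

   Many slopes: the functions of Basu, Conforti, Di Summa and Paat with f = 1/2.
   In the coordinate u = 2x and after adding u, such a function is nondecreasing,
   equal to 1 on [1, 2], and symmetric on [0, 1]; its left half is obtained from
   u |-> u by repeatedly replacing the initial segment by a scaled copy of the
   profile itself followed by a plateau, which creates one new slope, twice the
   previous largest one.  Starting instead from the profile that jumps to 1/4
   right after 0 makes the function discontinuous at 0.

   Discontinuity on both sides of 0: with f = 1/3, let p be 0 on Z, 1 on f + Z,
   1/3 on the set A = (0, 1/6) U (1/3, 2/3) mod 1, 2/3 on f - A, and 1/2 at the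
   two fixed points of x |-> f - x.  Any two nonzero values then sum to at least
   2/3, which makes p subadditive; triples in A with sum f mod 1 give extremality. *)

Require Import Defs.
From mathcomp Require Import all_boot all_order all_algebra.
From mathcomp Require Import all_classical all_reals all_analysis.
From mathcomp Require Import ring lra zify.

Set Implicit Arguments.
Unset Strict Implicit.
Unset Printing Implicit Defensive.

Import Order.TTheory GRing.Theory Num.Theory.
Import numFieldNormedType.Exports.

Local Open Scope classical_set_scope.
Local Open Scope ring_scope.

(** * Valid and extreme functions *)

Lemma fsbigT_seq (R : realType) (F : R -> R) (s : seq R) :
  uniq s -> (forall r, r \notin s -> F r = 0) ->
  \sum_(r \in [set: R]) F r = \sum_(r <- s) F r.
Proof.
move=> us F0; rewrite (fsbig_seq _ _ us).
by apply/esym/fsbig_widen => // r [_ /negP] /F0.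
Qed.

(** A half-space is convex, so the inequality passes from the solutions to their hull. Finite
    support is carried along in [X] because the sum is linear only over a common finite support. *)
Lemma group_problem_sum_ge1 (R : realType) (f : R) (p y : R -> R) :
  (forall z, integer_solution f z -> 1 <= \sum_(r \in [set: R]) p r * z r) ->
  group_problem f y -> 1 <= \sum_(r \in [set: R]) p r * y r.
Proof.
move=> ge1 fy.
pose X : set (R -> R) := [set z | finitely_supported z /\
  1 <= \sum_(r \in [set: R]) p r * z r].
suff [] : X y by [].
move: y fy; apply: smallest_sub; last first.
  by move=> z fz; split; [case: fz | exact: ge1].
move=> u v l; rewrite !inE => -[fu u1] [fv v1].
pose D := fset_set ([set r | u r != 0] `|` [set r | v r != 0]).
have finD : finite_set ([set r | u r != 0] `|` [set r | v r != 0]).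
  by rewrite finite_setU.
have uD r : r \notin finmap.enum_fset D -> u r = 0.
  rewrite in_fset_set // => /negP h; apply/eqP/negP => /negP ur; apply: h.
  by rewrite inE; left.
have vD r : r \notin finmap.enum_fset D -> v r = 0.
  rewrite in_fset_set // => /negP h; apply/eqP/negP => /negP ur; apply: h.
  by rewrite inE; right.
have convE r : (conv l u v : R -> R) r = l%:num * u r + (1 - l%:num) * v r.
  by [].
split.
  apply: sub_finite_set finD => r /=; rewrite convE => /negP h.
  have [ur|] := eqVneq (u r) 0; last by left.
  have [vr|] := eqVneq (v r) 0; last by right.
  by exfalso; apply: h; rewrite ur vr !mulr0 addr0.
have uD' := finmap.fset_uniq D.
rewrite (@fsbigT_seq _ _ _ uD'); last first.
  by move=> r rD; rewrite convE uD // vD // !mulr0 addr0 mulr0.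
rewrite (@fsbigT_seq _ _ _ uD') in u1; last by move=> r rD; rewrite uD ?mulr0.
rewrite (@fsbigT_seq _ _ _ uD') in v1; last by move=> r rD; rewrite vD ?mulr0.
under eq_bigr => r _ do rewrite convE mulrDr !(mulrCA (p r)).
rewrite big_split /= -!mulr_sumr.
have l0 : 0 <= l%:num by [].
have l1 : 0 <= 1 - l%:num by rewrite subr_ge0.
set a := \sum_(_ <- _) _ in u1 *; set b := \sum_(_ <- _) _ in v1 *.
have := mulr_ge0 l0 (_ : 0 <= a - 1); rewrite subr_ge0 => /(_ u1).
have := mulr_ge0 l1 (_ : 0 <= b - 1); rewrite subr_ge0 => /(_ v1).
lra.
Qed.

(** Subadditivity bounds the sum of the p (r) y (r) below by [p] at the sum of the r y (r), a point
    of f + Z. *)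
Lemma valid_of_subadditive (R : realType) (f : R) (p : R -> R) :
  (forall x, 0 <= p x) -> p 0 = 0 ->
  (forall x y, p (x + y) <= p x + p y) ->
  (forall x, x - f \is a Num.int -> 1 <= p x) ->
  valid_function f p.
Proof.
move=> p0 p00 psub pf; split=> // y; apply: group_problem_sum_ge1 => {}y.
case=> finy naty inty.
pose D := fset_set [set r | y r != 0].
have yD r : r \notin finmap.enum_fset D -> y r = 0.
  rewrite in_fset_set // => /negP h; apply/eqP/negP => /negP ur; apply: h.
  by rewrite inE.
have uD := finmap.fset_uniq D.
rewrite (@fsbigT_seq _ _ _ uD) in inty; last first.
  by move=> r rD; rewrite yD ?mulr0.
rewrite (@fsbigT_seq _ _ _ uD); last by move=> r rD; rewrite yD ?mulr0.
apply: le_trans (pf _ inty) _.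
elim/big_ind2 : _ => [|a b c d pab pcd|r _]; first by rewrite p00.
  exact: le_trans (psub _ _) (lerD _ _).
have /natrP[n ->] := naty r; rewrite !mulr_natr.
elim: n => [|n ih]; first by rewrite !mulr0n p00.
by rewrite !mulrS (le_trans (psub _ _))// lerD2l.
Qed.

Lemma valid_sum_ge1 (R : realType) (f : R) (p : R -> R) (s : seq R) :
  valid_function f p -> \sum_(r <- s) r - f \is a Num.int ->
  1 <= \sum_(r <- s) p r.
Proof.
move=> [_ pv] sf; pose y (r : R) : R := (count_mem r s)%:R.
have y0 r : r \notin undup s -> y r = 0.
  by rewrite mem_undup /y => /count_memPn ->.
have sumE (q : R -> R) : \sum_(r \in [set: R]) q r * y r = \sum_(r <- s) q r.
  rewrite (@fsbigT_seq _ _ _ (undup_uniq s)); last first.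
    by move=> r /y0 ->; rewrite mulr0.
  rewrite -[RHS](big_undup_iterop_count +%R); apply: eq_bigr => r _.
  by rewrite /y mulr_natr.
rewrite -sumE; apply: pv; apply: sub_smallest (_ : integer_solution f y) => //.
split; last by rewrite sumE.
  apply: (@sub_finite_set _ _ [set` undup s]) => // r /= yr.
  by apply/negPn/negP => /y0 /eqP; apply/negP.
by move=> r; rewrite natr_nat.
Qed.

Lemma extreme_of_rigid (R : realType) (f : R) (p : R -> R) :
  valid_function f p -> p 0 = 0 ->
  (forall x, p x + p (f - x) = 1) ->
  (forall x y, x - y \is a Num.int -> p x = p y) ->
  (forall q : R -> R, (forall x, 0 <= q x <= 1) -> q 0 = 0 ->
     (forall x, q x + q (f - x) = 1) ->
     (forall x y, x - y \is a Num.int -> q x = q y) ->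
     (forall x y, p (x + y) = p x + p y -> q (x + y) = q x + q y) ->
     forall x, q x = p x) ->
  extreme_function f p.
Proof.
move=> pv p0 psym pper rigid; split=> // p1 p2 v1 v2 pE.
suff key (q r : R -> R) : valid_function f q -> valid_function f r ->
    (forall x, p x = 2^-1 * (q x + r x)) -> forall x, q x = p x.
  split; apply/esym/funext; first exact: (key p1 p2).
  by apply: (key p2 p1) => // x; rewrite addrC.
move=> {p1 p2 v1 v2 pE} qv rv pE.
(* Both candidate sums are at least 1, and their average is 1. *)
have tight s : \sum_(x <- s) x - f \is a Num.int ->
    \sum_(x <- s) p x = 1 -> \sum_(x <- s) q x = 1.
  move=> sf; under eq_bigr do rewrite pE.
  rewrite -mulr_sumr big_split /=.
  by have := valid_sum_ge1 qv sf; have := valid_sum_ge1 rv sf; lra.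
have tight2 x y : x + y - f \is a Num.int -> q x + q y = 1.
  move=> xyf; have := tight [:: x; y].
  rewrite !big_cons !big_nil !addr0; apply => //.
  by rewrite (pper y (f - x)) ?psym// opprB addrC addrAC.
have qper x y : x - y \is a Num.int -> q x = q y.
  move=> xy; have := tight2 y (f - y); have := tight2 x (f - y).
  rewrite [y + _ - f](_ : _ = 0); last by ring.
  by rewrite [x + _ - f](_ : _ = x - y) ?rpred0; [move=> /(_ xy) + /(_ isT); lra|ring].
have qsym x : q x + q (f - x) = 1 by apply: tight2; rewrite subrKC subrr.
have qadd x y : p (x + y) = p x + p y -> q (x + y) = q x + q y.
  move=> pxy; have := tight [:: x; y; f - (x + y)].
  rewrite !big_cons !big_nil !addr0 addrA subrKC subrr rpred0 => /(_ isT).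
  by have := psym (x + y); have := qsym (x + y); lra.
apply: rigid => //.
- move=> x; rewrite qv.1 /=; have := qsym x; have := qv.1 (f - x); lra.
- by have := qadd 0 0; rewrite addr0 p0 => /(_ (esym (addr0 _))); lra.
Qed.

Lemma Cauchy_bounded_linear (R : realType) (L M : R) (g : R -> R) :
  0 < L -> (forall x, 0 <= x <= L -> `|g x| <= M) ->
  (forall x y, 0 <= x -> 0 <= y -> x + y <= L -> g (x + y) = g x + g y) ->
  forall x, 0 <= x <= L -> g x = g L / L * x.
Proof.
move=> L0 gM gD.
pose h x := g x - g L / L * x.
have hD x y : 0 <= x -> 0 <= y -> x + y <= L -> h (x + y) = h x + h y.
  by move=> *; rewrite /h gD//; lra.
have hL : h L = 0 by rewrite /h divfK ?subrr// gt_eqF.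
have hL2 : h (L / 2) = 0.
  by have := hD (L / 2) (L / 2); rewrite -splitr hL; lra.
pose K := M + `|g L|.
(* every value of [h] is half of another one, so each bound can be halved *)
have hK n x : 0 <= x <= L -> `|h x| <= K * 2^-1 ^+ n.
  elim: n x => [|n ih] x /andP[x0 xL].
    rewrite expr0 mulr1 (le_trans (ler_normB _ _))// lerD ?gM ?x0//.
    rewrite -mulrA normrM ler_piMr// normrM normfV !ger0_norm ?(ltW L0)//.
    by rewrite mulrC ler_pdivrMr// mul1r.
  have half z : 0 <= z <= L / 2 -> `|h z| <= K * 2^-1 ^+ n.+1.
    move=> /andP[z0 zL]; have := ih (z + z).
    rewrite hD//; last by lra.
    rewrite -[h z + _]mulr2n normrMn -mulr_natl exprS => H.
    by have := H ltac:(lra); lra.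
  (* Above [L / 2], translating by [L / 2] leaves [h] unchanged. *)
  have [xL2|xL2] := lerP x (L / 2); first by apply: half; lra.
  rewrite -(subrK (L / 2) x) hD; [|lra..]; rewrite hL2 addr0.
  by apply: half; lra.
move=> x xL; apply/eqP; rewrite -subr_eq0 -normr_le0; apply/ler_addgt0Pl => e e0.
rewrite addr0.
have K1 : 0 < K + 1.
  rewrite ltr_pwDr// addr_ge0// (le_trans _ (gM 0 _))// lexx ltW//.
have [n /= hn] : exists n : nat, (K + 1) / e < 2 ^+ n.
  have [n hn] : exists n : nat, (K + 1) / e < n%:R.
    exists (Num.trunc ((K + 1) / e)).+1.
    by rewrite truncnS_gt.
  by exists n; apply: lt_trans hn _; rewrite -natrX ltr_nat ltn_expl.
apply: le_trans (hK n x xL) _.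
rewrite exprVn ler_pdivrMr ?exprn_gt0//.
by move: hn; rewrite ltr_pdivrMr//; lra.
Qed.

(** Both g (a + y) + g (a + z) and g (a) + g (a + y + z) equal g (2a + y + z), so the increments
    from [a] are additive. The sum x + y may leave [a, a + L], where no bound is assumed. *)
Lemma restricted_Cauchy_affine (R : realType) (a L M : R) (g : R -> R) :
  0 < L -> (forall x, a <= x <= a + L -> `|g x| <= M) ->
  (forall x y, a <= x -> a <= y -> x + y <= 2 * a + L ->
     g (x + y) = g x + g y) ->
  forall x, a <= x <= a + L ->
    g x = g a + (g (a + L) - g a) / L * (x - a).
Proof.
move=> L0 gM gD x xL.
have := @Cauchy_bounded_linear _ L (M + M) (fun d => g (a + d) - g a) L0.
move=> /(_ _ _ (x - a)) /=; rewrite subrKC => <-; [lra| | |lra].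
  move=> y yL; rewrite (le_trans (ler_normB _ _))// lerD// gM; lra.
move=> y z y0 z0 yz.
have := gD (a + y) (a + z); have := gD a (a + (y + z)).
have -> : a + y + (a + z) = a + (a + (y + z)) by ring.
lra.
Qed.

(** * Piecewise linear functions on a grid *)

(** The interval is open: values at breakpoints stay free, which allows jumps. *)
Definition affine_between (R : realType) (p : R -> R) (a c d : R) :=
  exists b, forall x, c < x < d -> p x = a * x + b.

Definition affine_on_grid (R : realType) (N : R) (S : set R) (p : R -> R) :=
  forall i : int, exists2 a, S a & affine_between p a (i%:~R / N) ((i + 1)%:~R / N).

Lemma grid_piecewise_linear (R : realType) (N : R) (S : set R) (p : R -> R) :
  0 < N -> affine_on_grid N S p -> piecewise_linear p.
Proof.
move=> N0 pN.
pose cell (i : int) : set R := `[i%:~R / N, (i + 1)%:~R / N]%classic.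
have inside i x : (cell i)° x -> i%:~R / N < x < (i + 1)%:~R / N.
  by rewrite /cell interior_itv_bnd /= in_itv.
exists (range cell); split.
- move=> _ [i _ <-]; split; last exact: itv_closed.
  exact: interval_is_interval.
- rewrite -subTset => x _; exists (cell (Num.floor (x * N))).
    by exists (Num.floor (x * N)).
  rewrite /cell /= in_itv /= ler_pdivrMr// ler_pdivlMr//.
  by rewrite floor_le ltW// floorD1_gt.
- move=> _ _ [i _ <-] [j _ <-] ij; rewrite -subset0 => x [/inside + /inside].
  rewrite !ltr_pdivrMr// !ltr_pdivlMr// => /andP[ix xi] /andP[jx xj].
  apply: ij; congr cell.
  rewrite -(@floor_def _ (x * N) i) ?ltW ?ix//; apply: floor_def.
  by rewrite ltW.
- move=> B [M [_ BM]].
  have {}BM x : B x -> `|x| <= M + 1 by apply: (BM (M + 1)); rewrite ltrDl.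
  pose K := Num.ceil ((M + 1) * N).
  (* Only the 2K + 2 cells with index from -K - 1 to K can meet [B]. *)
  have fin := finite_image (fun n : nat => cell (n%:Z - K - 1))
    (finite_II (`|(K + K + 2)%R|%N)).
  apply: sub_finite_set fin.
  move=> J [[i _ <-] [x [+ /BM]]].
  rewrite /cell /= in_itv /= ler_norml ler_pdivrMr// ler_pdivlMr//.
  move=> /andP[ix xi] /andP[Mx xM].
  have xK : - K%:~R <= x * N <= K%:~R.
    have MK := ceil_ge ((M + 1) * N).
    have : - (M + 1) * N <= x * N by rewrite ler_wpM2r// ltW.
    have : x * N <= (M + 1) * N by rewrite ler_wpM2r// ltW.
    by rewrite mulNr -/K in MK *; lra.
  have iK : i <= K by rewrite -(ler_int R); lra.
  have Ki : - K <= i + 1 by rewrite -(ler_int R) rmorphN; lra.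
  exists `|(i + K + 1)%R|%N => /=; last by congr cell; lia.
  lia.
- move=> _ [i _ <-]; have [a _ [b pab]] := pN i.
  by exists a, b => x /inside; apply: pab.
Qed.

(** Derivability makes [p] continuous at [x], so [p x] lies on the affine piece to the right. Hence
    a breakpoint where [p] happens to be derivable adds no slope. *)
Lemma derive1_affine_right (R : realType) (p : R -> R) (x d a : R) :
  x < d -> affine_between p a x d -> derivable p x 1 -> derive1 p x = a.
Proof.
move=> xd [b pab] dp.
have px : p x = a * x + b.
  have cp : p t @[t --> x^'+] --> p x.
    apply: cvg_at_right_filter; apply: differentiable_continuous.
    exact/derivable1_diffP.
  have ca : p t @[t --> x^'+] --> a * x + b.
    apply: (@cvg_trans _ ((fun t => a * t + b) t @[t --> x^'+])).
      apply: near_eq_cvg; near=> t; apply/esym/pab/andP; split; near: t.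
        exact: nbhs_right_gt.
      exact: nbhs_right_lt.
    by apply: cvg_at_right_filter; apply: cvgD; [apply: cvgMr; apply: cvg_id|apply: cvg_cst].
  exact: (cvg_unique _ cp ca).
have dpa : h^-1 *: (p (h + x) - p x) @[h --> 0^'+] --> derive1 p x.
  apply: cvg_dnbhs_at_right.
  rewrite derive1E (_ : (fun h => _) =
    (fun h => h^-1 *: ((p \o shift x) (h *: 1) - p x))); first exact: dp.
  by apply/funext => h; rewrite /= [_ *: 1]mulr1.
have ca : h^-1 *: (p (h + x) - p x) @[h --> 0^'+] --> a.
  apply: (@cvg_trans _ (cst a h @[h --> (0 : R)^'+])); last exact: cvg_cst.
  apply: near_eq_cvg; near=> h; have h0 : 0 < h by near: h; exact: nbhs_right_gt.
  rewrite /= pab; last first.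
    rewrite ltrDr h0 -ltrBrDr; near: h; apply: nbhs_right_lt.
    by rewrite subr_gt0.
  rewrite px (_ : _ - _ = h * a); last by ring.
  by rewrite [_ *: _]mulKf// gt_eqF.
exact: (cvg_unique _ dpa ca).
Unshelve. all: by end_near. Qed.

Lemma derivable_affine (R : realType) (p : R -> R) (a c x d : R) :
  c < x < d -> affine_between p a c d -> derivable p x 1.
Proof.
move=> /andP[cx xd] [b pab].
apply: (@near_eq_derivable _ _ _ (fun t => a * t + b)).
  near=> t; apply/esym/pab/andP; split; near: t.
    exact: lt_nbhsr.
  exact: lt_nbhsl.
exact: ex_derive.
Unshelve. all: by end_near. Qed.

Lemma slopes_grid (R : realType) (N : R) (S : set R) (p : R -> R) :
  0 < N -> affine_on_grid N S p ->
  (forall a, S a -> exists c d, c < d /\ affine_between p a c d) ->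
  slopes p = S.
Proof.
move=> N0 pN pS; apply/seteqP; split=> [_ [x dp ->]|a Sa].
  (* The cell chosen by the floor extends to the right of [x] even when [x] is a grid point. *)
  have [a Sa [b pab]] := pN (Num.floor (x * N)).
  rewrite (@derive1_affine_right _ _ x ((Num.floor (x * N) + 1)%:~R / N) a)//.
    by rewrite ltr_pdivlMr// floorD1_gt.
  exists b => y /andP[xy yd]; apply: pab; rewrite yd andbT.
  by rewrite (le_lt_trans _ xy)// ler_pdivrMr// floor_le.
have [c [d [cd pa]]] := pS a Sa.
have mid : c < (c + d) / 2 < d by lra.
have dp := derivable_affine mid pa.
exists ((c + d) / 2) => //; apply/esym/(@derive1_affine_right _ _ _ d) => //.
  by case/andP: mid.
case: pa => b pab; exists b => x /andP[mx xd]; apply: pab.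
by rewrite xd andbT (lt_trans _ mx)//; case/andP: mid.
Qed.

(** * A function discontinuous on both sides of the origin *)

Definition periodize (R : realType) (g : R -> R) (x : R) : R :=
  g (x - (Num.floor x)%:~R).

Lemma periodize_itv01 (R : realType) (g : R -> R) (x : R) :
  0 <= x < 1 -> periodize g x = g x.
Proof.
by move=> x01; rewrite /periodize (@floor_def _ x 0) ?subr0// mulr0z add0r.
Qed.

Lemma periodize_int (R : realType) (g : R -> R) (x y : R) :
  x - y \is a Num.int -> periodize g x = periodize g y.
Proof.
move=> /intrP[n xyn]; rewrite /periodize.
have -> : x = y + n%:~R by rewrite -xyn subrKC.
by rewrite floorDrz// intrKfloor rmorphD /= opprD addrACA subrr addr0.
Qed.

Lemma sub_floor_itv (R : realType) (x : R) : 0 <= x - (Num.floor x)%:~R < 1.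
Proof. by have := floor_itv x; rewrite intrD; lra. Qed.

Lemma periodic_ind (R : realType) (P : R -> Prop) :
  (forall x y, x - y \is a Num.int -> P y -> P x) ->
  (forall x, 0 <= x < 1 -> P x) -> forall x, P x.
Proof.
move=> Pint P01 x; apply: Pint (P01 _ (sub_floor_itv x)).
by rewrite subKr.
Qed.

Lemma periodic_grid (R : realType) (n : nat) (S : set R) (p : R -> R) :
  (0 < n)%N -> (forall x y, x - y \is a Num.int -> p x = p y) ->
  (forall r, (r < n)%N ->
     exists2 a, S a & affine_between p a (r%:R / n%:R) (r.+1%:R / n%:R)) ->
  affine_on_grid n%:R S p.
Proof.
move=> n0 pper pn i.
have nR : 0 < n%:R :> R by rewrite ltr0n.
pose m := (i %/ n)%Z.
have [r ir] : exists r : nat, (i %% n)%Z = r.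
  by exists `|(i %% n)%Z|%N; rewrite gez0_abs// modz_ge0//; lia.
have rn : (r < n)%N by have := @ltz_pmod i n; rewrite ir; lia.
have [a Sa [b pab]] := pn r rn; exists a => //; exists (b - a * m%:~R) => x.
have iE : i = m * n + r by rewrite -ir; exact: divz_eq.
have iR : i%:~R = m%:~R * n%:R + r%:R :> R by rewrite iE intrD intrM.
rewrite intrD ltr_pdivrMr// ltr_pdivlMr// iR => ix.
rewrite (pper x (x - m%:~R)) ?subKr// pab; first by lra.
by rewrite ltr_pdivrMr// ltr_pdivlMr// -addn1 natrD; lra.
Qed.

Definition two_sided_profile (R : realType) (x : R) : R :=
  if x == 0 then 0 else
  if x < 1 / 6 then 1 / 3 else
  if x == 1 / 6 then 1 / 2 else
  if x < 1 / 3 then 2 / 3 else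
  if x == 1 / 3 then 1 else
  if x < 2 / 3 then 1 / 3 else
  if x == 2 / 3 then 1 / 2 else 2 / 3.

Definition two_sided (R : realType) : R -> R :=
  periodize (@two_sided_profile R).

Section TwoSided.
Variable R : realType.
Local Notation p := (@two_sided R).
Local Notation f := (1 / 3 : R).

Let p01 (x : R) : 0 <= x < 1 -> p x = two_sided_profile x.
Proof. exact: periodize_itv01. Qed.

Let pint (x y : R) : x - y \is a Num.int -> p x = p y.
Proof. exact: periodize_int. Qed.

Let p0 : p 0 = 0.
Proof. by rewrite p01 ?lexx ?ltr01// /two_sided_profile eqxx. Qed.

Ltac profile_cases := rewrite /two_sided_profile;
  repeat (case: ltgtP => ?; try lra).

Let pA1 (x : R) : 0 < x < 1 / 6 -> p x = 1 / 3.
Proof. by move=> xA; rewrite p01; [profile_cases|lra]. Qed.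

Let pmid1 : p (1 / 6) = 1 / 2.
Proof. by rewrite p01; [profile_cases|lra]. Qed.

Let pB1 (x : R) : 1 / 6 < x < f -> p x = 2 / 3.
Proof. by move=> xA; rewrite p01; [profile_cases|lra]. Qed.

Let pf : p f = 1.
Proof. by rewrite p01; [profile_cases|lra]. Qed.

Let pA2 (x : R) : f < x < 2 / 3 -> p x = 1 / 3.
Proof. by move=> xA; rewrite p01; [profile_cases|lra]. Qed.

Let pmid2 : p (2 / 3) = 1 / 2.
Proof. by rewrite p01; [profile_cases|lra]. Qed.

Let pB2 (x : R) : 2 / 3 < x < 1 -> p x = 2 / 3.
Proof. by move=> xA; rewrite p01; [profile_cases|lra]. Qed.

(* The symmetry of [g] mod 1 swaps the pieces on [0, f] and on [f, 1]. *)
Let piece_ind (g : R -> R) :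
  (forall x y, x - y \is a Num.int -> g x = g y) -> (forall x, g x + g (f - x) = 1) ->
  g 0 = 0 -> (forall x, 0 < x < 1 / 6 -> g x = 1 / 3) ->
  (forall x, f < x < 2 / 3 -> g x = 1 / 3) -> forall x, g x = p x.
Proof.
move=> gint gsym g0 gA1 gA2.
have gsym1 x : g x + g (4 / 3 - x) = 1.
  rewrite (gint (4 / 3 - x) (f - x)) ?gsym//.
  by rewrite (_ : _ - _ = 1) ?rpred1//; lra.
apply: periodic_ind => [x y xy|x x01]; first by rewrite (pint xy) (gint _ _ xy).
have [x0|x0|->] := ltgtP x 0; [by lra| |by rewrite p0].
have [x1|x1|->] := ltgtP x (1 / 6); first by rewrite pA1 ?gA1; lra.
- have [x2|x2|->] := ltgtP x f.
  + by rewrite pB1; [have := gsym x; rewrite (gA1 (f - x)); lra|lra].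
  + have [x3|x3|->] := ltgtP x (2 / 3); first by rewrite pA2 ?gA2; lra.
      by rewrite pB2; [have := gsym1 x; rewrite (gA2 (4 / 3 - x)); lra|lra].
    by rewrite pmid2; have := gsym1 (2 / 3); rewrite (_ : 4 / 3 - 2 / 3 = 2 / 3); lra.
  + by rewrite pf; have := gsym 0; rewrite subr0; lra.
- by rewrite pmid1; have := gsym (1 / 6); rewrite (_ : f - 1 / 6 = 1 / 6); lra.
Qed.

Let psym (x : R) : p x + p (f - x) = 1.
Proof.
suff <- : 1 - p (f - x) = p x by rewrite subrK.
move: x; apply: periodic_ind => [x y xy|x x01].
  rewrite (pint xy) (@pint (f - x) (f - y)) //.
  by rewrite opprB addrC addrA subrK -opprB rpredN.
have pf1 : p (f - x) = p (4 / 3 - x).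
  by apply: pint; rewrite (_ : _ - _ = - 1) ?rpredN1//; lra.
have [x0|x0|->] := ltgtP x 0; [by lra| |by rewrite subr0 p0 pf subrr].
have [x1|x1|->] := ltgtP x (1 / 6); first by rewrite [p x]pA1 ?[p _]pB1; lra.
- have [x2|x2|->] := ltgtP x f.
  + by rewrite [p x]pB1 ?[p _]pA1; lra.
  + rewrite pf1; have [x3|x3|->] := ltgtP x (2 / 3).
    * by rewrite [p x]pA2 ?[p _]pB2; lra.
    * by rewrite [p x]pB2 ?[p _]pA2; lra.
    * by rewrite (_ : 4 / 3 - 2 / 3 = 2 / 3) ?pmid2; lra.
  + by rewrite subrr p0 pf subr0.
- by rewrite (_ : f - 1 / 6 = 1 / 6) ?pmid1; lra.
Qed.

Let p_ge (x : R) : x \isn't a Num.int -> 1 / 3 <= p x.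
Proof.
move: x; apply: periodic_ind => [x y xy|x x01 xint].
  rewrite (pint xy) => h xint; apply: h; apply: contra xint => yint.
  by rewrite -(subrK y x) rpredD.
have x0 : x != 0 by apply: contraNneq xint => ->; rewrite rpred0.
rewrite p01// /two_sided_profile (negbTE x0); profile_cases.
Qed.

Let p_ge0 x : 0 <= p x.
Proof.
have [xint|/p_ge] := boolP (x \is a Num.int); last by lra.
by rewrite (@pint x 0) ?subr0// p0.
Qed.

Let p_sub (x y : R) : p (x + y) <= p x + p y.
Proof.
have [xint|xint] := boolP (x \is a Num.int).
  have xyy : x + y - y \is a Num.int by rewrite addrK.
  by rewrite (pint xyy) lerDr.
have [yint|yint] := boolP (y \is a Num.int).
  have xyx : x + y - x \is a Num.int by rewrite addrAC subrr add0r.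
  by rewrite (pint xyx) lerDl.
have := psym (x + y); have := p_ge xint; have := p_ge yint.
(* If f - (x + y) is not an integer, symmetry gives p (x + y) <= 2/3 <= p x + p y. If it is one,
   symmetry gives p x + p y = 1. *)
have [xyf|/p_ge] := boolP (f - (x + y) \is a Num.int); last by lra.
rewrite (@pint (f - (x + y)) 0) ?subr0// p0.
have := psym x; rewrite (@pint (f - x) y); first lra.
by rewrite -addrA -opprD.
Qed.

Let rigid (q : R -> R) :
  (forall x, 0 <= q x <= 1) -> q 0 = 0 ->
  (forall x, q x + q (f - x) = 1) ->
  (forall x y, x - y \is a Num.int -> q x = q y) ->
  (forall x y, p (x + y) = p x + p y -> q (x + y) = q x + q y) ->
  forall x, q x = p x.
Proof.
move=> q01 q0 qsym qint qadd.
(* Here p (x + y) = 1 - p z = 2/3 = p x + p y, so [q] inherits an additive relation. *)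
have tri x y z : p x = 1 / 3 -> p y = 1 / 3 -> p z = 1 / 3 ->
    x + y + z - f \is a Num.int -> q x + q y + q z = 1.
  move=> px py pz xyz.
  have zint : z - (f - (x + y)) \is a Num.int.
    by rewrite (_ : _ - _ = x + y + z - f)//; lra.
  rewrite -qadd; first by rewrite (qint _ _ zint) qsym.
  by have := psym (x + y); rewrite -(pint zint); lra.
(* [e] is centered at 4/9, where three times the argument is f + 1 *)
pose e (u : R) := q (4 / 9 + u) - 1 / 3.
have triE u v w : - (1 / 9) < u < 2 / 9 -> - (1 / 9) < v < 2 / 9 ->
    - (1 / 9) < w < 2 / 9 -> u + v + w = 0 -> e u + e v + e w = 0.
  move=> hu hv hw uvw.
  have := @tri (4 / 9 + u) (4 / 9 + v) (4 / 9 + w).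
  rewrite !pA2; try lra.
  rewrite [_ - f](_ : _ = 1); last by lra.
  by rewrite rpred1 /e => /(_ erefl erefl erefl isT); lra.
pose a := e (1 / 10) / (1 / 10).
(* The bound 1/10 keeps -(u + v) above -1/9, where [triE] applies. *)
have eD u v : 0 <= u -> 0 <= v -> u + v <= 1 / 10 -> e (u + v) = e u + e v.
  move=> u0 v0 uv; have := triE (u + v) (- (u + v)) 0.
  have := triE u v (- (u + v)); have := triE 0 0 0; lra.
have eL1 u : 0 <= u <= 1 / 10 -> e u = a * u.
  apply: (@Cauchy_bounded_linear _ _ 1 e) => // v _.
  by rewrite /e ler_norml; have := q01 (4 / 9 + v); lra.
(* The triple u, -u/2, -u/2 carries linearity to negative arguments, and from there to positive ones
   up to 2/9. *)
have eL2 u : - (1 / 9) < u <= 0 -> e u = a * u.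
  move=> u0; have := triE u (- u / 2) (- u / 2).
  by have := eL1 (- u / 2); lra.
have eL u : - (1 / 9) < u < 2 / 9 -> e u = a * u.
  move=> u0; have [un|up] := lerP u 0; first by apply: eL2; lra.
  have := triE u (- u / 2) (- u / 2).
  by have := eL2 (- u / 2); lra.
have qA1' x : 0 < x < 1 / 6 -> q x = 1 / 3 + a * (x - 4 / 9).
  (* Since x + 2y = 4/3 = f + 1 and y lies in (7/12, 2/3), the value at [x] follows from the linear
     formula at [y]. *)
  move=> xA; pose y := (4 / 3 - x) / 2.
  have := @tri x y y; rewrite pA1// pA2 ?/y; last by lra.
  rewrite [_ - f](_ : _ = 1); last by lra.
  rewrite rpred1 => /(_ erefl erefl erefl isT).
  by have := eL (y - 4 / 9); rewrite /e subrKC /y; lra.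
(* Three times 1/9 is f, so q (1/9) = 1/3, whereas the affine formula gives 1/3 - a/3. *)
have a0 : a = 0.
  have := @tri (1 / 9) (1 / 9) (1 / 9); rewrite pA1; last by lra.
  rewrite [_ - f](_ : _ = 0); last by lra.
  rewrite rpred0 => /(_ erefl erefl erefl isT).
  by rewrite qA1'; lra.
have qA1 x : 0 < x < 1 / 6 -> q x = 1 / 3 by move=> /qA1'; rewrite a0; lra.
apply: piece_ind => // x xA; have := eL (x - 4 / 9); rewrite /e subrKC a0; lra.
Qed.

Lemma two_sided_extreme : extreme_function f p.
Proof.
apply: (extreme_of_rigid _ p0 psym pint rigid).
apply: (valid_of_subadditive p_ge0 p0 p_sub).
move=> x xf; rewrite (pint xf); have := psym 0; rewrite subr0 p0; lra.
Qed.

Lemma two_sided_piecewise_linear : piecewise_linear p.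
Proof.
have N0 : 0 < 6%:R :> R by rewrite ltr0n.
apply: (grid_piecewise_linear N0 (S := setT)).
apply: periodic_grid => [//|x y|r r6]; first exact: periodize_int.
exists 0 => //.
suff [b pb] : exists b, forall x, r%:R / 6 < x < r.+1%:R / 6 -> p x = b.
  by exists b => x /pb ->; rewrite mul0r add0r.
case: r r6 => [|[|[|[|[|[|//]]]]]] _.
- by exists (1 / 3) => x xr; apply: pA1; lra.
- by exists (2 / 3) => x xr; apply: pB1; lra.
- by exists (1 / 3) => x xr; apply: pA2; lra.
- by exists (1 / 3) => x xr; apply: pA2; lra.
- by exists (2 / 3) => x xr; apply: pB2; lra.
- by exists (2 / 3) => x xr; apply: pB2; lra.
Qed.

Lemma two_sided_not_left_continuous : ~ continuous_from_left p 0.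
Proof.
rewrite /continuous_from_left p0 => pl.
suff : 2 / 3 <= 0 :> R by lra.
apply: (cvgr_to_ge pl); near=> t.
have t0 : t < 0 by near: t; exact: nbhs_left_lt.
have t1 : - (1 / 3) < t by near: t; apply: nbhs_left_gt; lra.
by rewrite (@pint t (t + 1)) ?pB2 ?opprD ?addNKr ?rpredN1//; lra.
Unshelve. all: by end_near. Qed.

Lemma two_sided_not_right_continuous : ~ continuous_from_right p 0.
Proof.
rewrite /continuous_from_right p0 => pr.
suff : 1 / 3 <= 0 :> R by lra.
apply: (cvgr_to_ge pr); near=> t.
have t0 : 0 < t by near: t; exact: nbhs_right_gt.
have t1 : t < 1 / 6 by near: t; apply: nbhs_right_lt; lra.
by rewrite pA1//; lra.
Unshelve. all: by end_near. Qed.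

End TwoSided.

(** * Profiles *)

(** For a profile: a copy of [phi] shrunk by 8 horizontally and by 4 vertically, then a plateau on
    [1/8, 1/4], then the identity. The copy doubles all slopes. The closed form gives monotonicity
    and continuity at once. *)
Definition graft (R : realType) (phi : R -> R) (u : R) : R :=
  Num.max u (Num.min (1 / 4) (phi (8 * u) / 4)).

Definition profile (R : realType) (phi : R -> R) : Prop :=
  [/\ {homo phi : x y / x <= y},
      forall u : R, u <= 0 -> phi u = 0,
      forall u : R, 1 / 4 <= u -> phi u = u,
      forall u : R, u <= phi u
    & forall x y : R, 0 <= x -> 0 <= y -> phi (x + y) <= phi x + phi y].

(** The relations are those a valid candidate inherits: additivity and equality on level sets. The
    bound [M] is arbitrary because passing to a shrunk copy multiplies it by 4. *)
Definition rigid_profile (R : realType) (phi : R -> R) : Prop :=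
  forall (q : R -> R) (M : R),
    (forall x : R, 0 <= x <= 1 -> `|q x| <= M) ->
    (forall x y : R, 0 <= x -> 0 <= y -> x + y <= 1 ->
       phi (x + y) = phi x + phi y -> q (x + y) = q x + q y) ->
    (forall x y : R, 0 <= x <= 1 -> 0 <= y <= 1 -> phi x = phi y -> q x = q y) ->
    q 1 = 1 ->
    forall x : R, 0 <= x <= 1 -> q x = phi x.

Definition dyadic_slopes {R : realType} (k : nat) : set R :=
  [set a | a = 0 \/ exists2 i, (i <= k)%N & a = 2 ^+ i].

Definition affine_cells (R : realType) (N : nat) (S : set R) (phi : R -> R) :=
  forall r : nat,
    exists2 a, S a & affine_between phi a (r%:R / N%:R) (r.+1%:R / N%:R).

(** The range [0, 1/2] is where symmetrization leaves a profile unchanged. *)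
Definition attains_slope (R : realType) (phi : R -> R) (a : R) :=
  exists c d, [/\ 0 <= c, c < d, d <= 1 / 2 & affine_between phi a c d].

Section Graft.
Variables (R : realType) (phi : R -> R).
Hypothesis phiP : profile phi.

Let phi_homo : {homo phi : x y / x <= y}. Proof. by case: phiP. Qed.
Let phi_le0 (u : R) : u <= 0 -> phi u = 0. Proof. by case: phiP => _ h *; apply: h. Qed.
Let phi_id (u : R) : 1 / 4 <= u -> phi u = u. Proof. by case: phiP => _ _ h *; apply: h. Qed.
Let phi_ge (u : R) : u <= phi u. Proof. by case: phiP => _ _ _ h *; apply: h. Qed.
Let phi_sub (x y : R) : 0 <= x -> 0 <= y -> phi (x + y) <= phi x + phi y.
Proof. by case: phiP => _ _ _ _ h *; apply: h. Qed.

Let phi_ge0 (u : R) : 0 <= phi u.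
Proof.
have [u0|u0] := lerP u 0; first by rewrite phi_le0.
by rewrite (le_trans (ltW u0)).
Qed.

Lemma graft_le18 (u : R) : u <= 1 / 8 -> graft phi u = phi (8 * u) / 4.
Proof.
move=> u8; rewrite /graft.
have phi1 : phi (8 * u) <= 1.
  by rewrite -[leRHS]phi_id; [apply: phi_homo; lra|lra].
rewrite min_r; last by lra.
rewrite max_r//; have := phi_ge (8 * u); have := phi_ge0 (8 * u); lra.
Qed.

Lemma graft_ge18 (u : R) : 1 / 8 <= u -> graft phi u = Num.max u (1 / 4).
Proof. by move=> u8; rewrite /graft min_l// phi_id; lra. Qed.

Lemma graft_mid (u : R) : 1 / 8 <= u <= 1 / 4 -> graft phi u = 1 / 4.
Proof. by move=> u8; rewrite graft_ge18 ?max_r; lra. Qed.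

Lemma graft_ge14 (u : R) : 1 / 4 <= u -> graft phi u = u.
Proof. by move=> u8; rewrite graft_ge18 ?max_l; lra. Qed.

(** For x + y <= 1/8 subadditivity is that of [phi]. Otherwise the left side is the larger of x + y
    and 1/4. The first is bounded since the graft lies above the identity. The second is reached by
    a single summand above 1/8, or, if both are below, because there the graft is at least 2u. *)
Lemma graft_profile : profile (graft phi).
Proof.
have graft_homo : {homo graft phi : x y / x <= y}.
  move=> x y xy; rewrite /graft ge_max !le_max xy /=; apply/orP; right.
  have : phi (8 * x) <= phi (8 * y) by apply: phi_homo; lra.
  by rewrite le_min !ge_min lexx /= => phixy; apply/orP; right; lra.
have graft_geid u : u <= graft phi u by rewrite /graft le_max lexx.
split=> //.
- by move=> u u0; rewrite graft_le18 ?phi_le0; lra.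
- exact: graft_ge14.
move=> x y x0 y0; have [xy|xy] := lerP (x + y) (1 / 8).
  rewrite !graft_le18; try lra.
  by have := @phi_sub (8 * x) (8 * y); rewrite mulrDr; lra.
rewrite graft_ge18 ?ge_max; last by lra.
rewrite lerD//=.
have ge2 (u : R) : 0 <= u <= 1 / 8 -> 2 * u <= graft phi u.
  by move=> u0; rewrite graft_le18; [have := phi_ge (8 * u); lra|lra].
have [xs|xs] := lerP x (1 / 8); have [ys|ys] := lerP y (1 / 8).
- by have := ge2 x; have := ge2 y; lra.
- have : graft phi (1 / 8) <= graft phi y by apply: graft_homo; lra.
  by have := graft_geid x; rewrite (@graft_mid (1 / 8)); lra.
- have : graft phi (1 / 8) <= graft phi x by apply: graft_homo; lra.
  by have := graft_geid y; rewrite (@graft_mid (1 / 8)); lra.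
- have : graft phi (1 / 8) <= graft phi x by apply: graft_homo; lra.
  by have := graft_geid y; rewrite (@graft_mid (1 / 8)); lra.
Qed.

(** Scaling by 8 maps cells of mesh 1/(8N) to cells of mesh 1/N; the breakpoints 1/8 and 1/4 are the
    grid points of index N and 2N. *)
Lemma graft_cells (N k : nat) : (0 < N)%N ->
  affine_cells N (dyadic_slopes k) phi ->
  affine_cells (8 * N) (dyadic_slopes k.+1) (graft phi).
Proof.
move=> N0 phiN r; have NR : 0 < N%:R :> R by rewrite ltr0n.
have cellE (x : R) : (r%:R / (8 * N)%:R < x < r.+1%:R / (8 * N)%:R) =
    (r%:R < 8 * x * N%:R < r.+1%:R).
  by rewrite natrM ltr_pdivrMr ?ltr_pdivlMr ?mulr_gt0// mulrA (mulrC x).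
have [rN|rN] := ltnP r N.
  have [a Sa [b phiab]] := phiN r; exists (2 * a).
    case: Sa => [->|[i ik ->]]; first by left; rewrite mulr0.
    by right; exists i.+1; rewrite ?exprS.
  exists (b / 4) => x; rewrite cellE => /andP[rx xr].
  have xN : 8 * x * N%:R <= 1 * N%:R.
    by rewrite mul1r (le_trans (ltW xr))// ler_nat.
  rewrite ler_pM2r// in xN.
  rewrite graft_le18; last by lra.
  by rewrite phiab ?ltr_pdivrMr ?ltr_pdivlMr ?rx//; lra.
have xN (x : R) : r%:R < 8 * x * N%:R -> 1 <= 8 * x.
  move=> rx; rewrite -(ler_pM2r NR) mul1r (le_trans _ (ltW rx))//.
  by rewrite ler_nat.
have [r2|r2] := ltnP r (2 * N).
  exists 0; first by left.
  exists (1 / 4) => x; rewrite cellE => /andP[rx xr].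
  have x2 : 8 * x * N%:R <= 2 * N%:R.
    by rewrite (le_trans (ltW xr))// -natrM ler_nat.
  by rewrite ler_pM2r// in x2; rewrite graft_mid ?mul0r ?add0r//; have := xN _ rx; lra.
exists 1; first by right; exists 0.
exists 0 => x; rewrite cellE => /andP[rx xr].
have x2 : 2 * N%:R <= 8 * x * N%:R.
  by rewrite (le_trans _ (ltW rx))// -natrM ler_nat.
by rewrite ler_pM2r// in x2; rewrite graft_ge14 ?mul1r ?addr0//; lra.
Qed.

Lemma graft_attains0 : attains_slope (graft phi) 0.
Proof.
exists (1 / 8), (1 / 4); split; [lra..|]; exists (1 / 4) => x xI.
by rewrite graft_mid; lra.
Qed.

Lemma graft_attains (k : nat) :
  (forall i, (i <= k)%N -> attains_slope phi (2 ^+ i)) ->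
  forall i, (i <= k.+1)%N -> attains_slope (graft phi) (2 ^+ i).
Proof.
move=> ph [_|i ik].
  exists (1 / 4), (1 / 2); split; [lra..|]; exists 0 => x xI.
  by rewrite graft_ge14; lra.
have [c [d [c0 cd d2 [b phib]]]] := ph i ik.
exists (c / 8), (d / 8); split; [lra..|]; exists (b / 4) => x xI.
by rewrite graft_le18 ?phib ?exprS; lra.
Qed.

End Graft.

(** With a = 1/4 and L = 1/2, the sum bound 2a + L is 1, so [q] is affine on [1/4, 3/4]. Halving 1
    twice gives q (1/2) = 1/2 and q (1/4) = 1/4, and points above 3/4 are doubles of points in that
    interval. *)
Lemma tail_rigid (R : realType) (q : R -> R) (M : R) :
  (forall x : R, 0 <= x <= 1 -> `|q x| <= M) ->
  (forall x y : R, 1 / 4 <= x -> 1 / 4 <= y -> x + y <= 1 ->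
     q (x + y) = q x + q y) ->
  q 1 = 1 ->
  forall x : R, 1 / 4 <= x <= 1 -> q x = x.
Proof.
move=> qM qD q1.
have L0 : 0 < 1 / 2 :> R by lra.
have qa (x : R) : 1 / 4 <= x <= 3 / 4 ->
    q x = q (1 / 4) + (q (1 / 4 + 1 / 2) - q (1 / 4)) / (1 / 2) * (x - 1 / 4).
  move=> xI; apply: (@restricted_Cauchy_affine _ _ _ M) => //; last by lra.
    by move=> y yI; apply: qM; lra.
  by move=> y z y0 z0 yz; apply: qD; lra.
have q2 : q (1 / 2) = q (1 / 4) + q (1 / 4) by rewrite -qD; [congr q; lra|lra..].
have q3 : q (1 / 2) + q (1 / 2) = 1.
  by rewrite -qD; [rewrite -[RHS]q1; congr q; lra|lra..].
have qm : q (1 / 2) = _ := qa (1 / 2) ltac:(lra).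
have q14 : q (1 / 4) = 1 / 4 by lra.
have q34 : q (1 / 4 + 1 / 2) = 3 / 4 by lra.
have qid (x : R) : 1 / 4 <= x <= 3 / 4 -> q x = x.
  by move=> xI; rewrite qa// q34 q14; lra.
move=> x xI; have [x3|x3] := lerP x (3 / 4); first by apply: qid; lra.
by rewrite (splitr x) qD ?qid; lra.
Qed.

(** Additivity fixes the tail, the level set of 1/4 fixes the plateau, and 4 q (u / 8) is a
    candidate for [phi], normalized by q (1/8) = 1/4. *)
Lemma graft_rigid (R : realType) (phi : R -> R) :
  profile phi -> rigid_profile phi -> rigid_profile (graft phi).
Proof.
move=> phiP phiR q M qM qD qlev q1.
have lge14 := graft_ge14 phiP; have lmid := graft_mid phiP; have lle18 := graft_le18 phiP.
have qt : forall x : R, 1 / 4 <= x <= 1 -> q x = x.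
  apply: (@tail_rigid _ _ M) => // x y x4 y4 xy.
  by apply: qD; rewrite ?lge14; lra.
have q14 : q (1 / 4) = 1 / 4 by apply: qt; lra.
have qmid x : 1 / 8 <= x <= 1 / 4 -> q x = 1 / 4.
  by move=> xI; rewrite -q14; apply: qlev; rewrite ?lmid; lra.
move=> x xI; have [x8|x8] := lerP x (1 / 8); last first.
  have [x4|x4] := lerP x (1 / 4); first by rewrite lmid ?qmid; lra.
  by rewrite lge14 ?qt; lra.
rewrite lle18// -(@phiR (fun u => 4 * q (u / 8)) (4 * M)).
- by rewrite mulrC mulKf// mulrC mulKf.
- by move=> u uI; rewrite normrM ger0_norm// ler_pM2l// qM; lra.
- move=> u v u0 v0 uv phiuv; rewrite /= [(u + v) / 8]mulrDl qD; [lra..|].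
  by rewrite -mulrDl !lle18; try lra; rewrite !(mulrC 8) !divfK// phiuv mulrDl.
- move=> u v uI vI phiuv; congr (4 * _); apply: qlev; [lra..|].
  by rewrite !lle18; try lra; rewrite !(mulrC 8) !divfK// phiuv.
- by rewrite qmid; lra.
- by lra.
Qed.

(** * The two initial profiles, continuous and discontinuous *)

Definition relu (R : realType) (u : R) : R := Num.max 0 u.

Definition step (R : realType) (u : R) : R :=
  if u <= 0 then 0 else Num.max u (1 / 4).

Lemma relu_profile (R : realType) : profile (@relu R).
Proof.
rewrite /relu; split.
- by move=> x y xy; rewrite ge_max !le_max lexx xy orbT.
- by move=> u u0; rewrite max_l.
- by move=> u u0; rewrite max_r; lra.
- by move=> u; rewrite le_max lexx orbT.
- by move=> x y x0 y0; rewrite !max_r ?addr_ge0.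
Qed.

Lemma step_profile (R : realType) : profile (@step R).
Proof.
have stepge u : u <= @step R u.
  by rewrite /step; case: ifP => // _; rewrite le_max lexx.
rewrite /step; split=> //.
- move=> x y xy; have [x0|x0] := lerP x 0; have [y0|y0] := lerP y 0 => //.
  + by rewrite le_max; lra.
  + by lra.
  + by rewrite ge_max !le_max lexx xy orbT.
- by move=> u ->.
- by move=> u u4; rewrite max_l// ifN// -ltNge; lra.
- move=> x y x0 y0; have [->|xn] := eqVneq x 0; first by rewrite lexx !add0r.
  have [->|yn] := eqVneq y 0; first by rewrite lexx !addr0.
  have {xn}x0 : 0 < x by rewrite lt_neqAle eq_sym xn.
  have {yn}y0 : 0 < y by rewrite lt_neqAle eq_sym yn.
  rewrite !ifN -?ltNge ?addr_gt0// ge_max lerD ?le_max ?lexx//=.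
  by rewrite -[leLHS]addr0 lerD// ?le_max ?lexx ?orbT ?(ltW y0).
Qed.

Lemma relu_rigid (R : realType) : rigid_profile (@relu R).
Proof.
move=> q M qM qD _ q1 x xI.
rewrite (@Cauchy_bounded_linear _ 1 M q)//; first by rewrite /relu max_r ?q1; lra.
by move=> y z y0 z0 yz; apply: qD => //; rewrite /relu !max_r ?addr_ge0.
Qed.

Lemma step_rigid (R : realType) : rigid_profile (@step R).
Proof.
move=> q M qM qD qlev q1 x xI.
have [_ _ step_id _ _] := step_profile R.
have qt : forall y, 1 / 4 <= y <= 1 -> q y = y.
  apply: (@tail_rigid _ _ M) => // y z y4 z4 yz.
  by apply: qD; rewrite ?step_id; lra.
have [x4|x4] := lerP (1 / 4) x; first by rewrite step_id// qt; lra.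
have step0 : @step R 0 = 0 by rewrite /step lexx.
have [x0|x0] := eqVneq x 0.
  by have := qD 0 0; rewrite x0 addr0 step0; lra.
(* On (0, 1/4] [step] is constant, so the level set transports the value of [q] at 1/4. *)
have stepx : step x = 1 / 4.
  rewrite /step max_r ?(ltW x4)// ifN// -ltNge lt_neqAle eq_sym x0.
  by case/andP: xI.
by rewrite stepx (@qlev x (1 / 4)) ?qt ?stepx ?step_id; lra.
Qed.

Lemma dyadic_slopes01 (R : realType) (a : R) :
  a = 0 \/ a = 1 -> dyadic_slopes 0 a.
Proof. by case=> ->; [left|right; exists 0]. Qed.

Lemma cell_ge0 (R : realType) (r n : nat) (x : R) :
  r%:R / n%:R < x -> 0 < x.
Proof. by apply: le_lt_trans; rewrite divr_ge0. Qed.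

Lemma relu_cells (R : realType) : affine_cells 4 (dyadic_slopes 0) (@relu R).
Proof.
move=> r; exists 1; first by apply: dyadic_slopes01; right.
by exists 0 => x /andP[/cell_ge0 x0 _]; rewrite /relu max_r ?(ltW x0)//; lra.
Qed.

Lemma step_cells (R : realType) : affine_cells 4 (dyadic_slopes 0) (@step R).
Proof.
case=> [|r].
  exists 0; first by apply: dyadic_slopes01; left.
  exists (1 / 4) => x xI.
  by rewrite /step ifN ?max_r; [lra..|rewrite -ltNge; lra].
exists 1; first by apply: dyadic_slopes01; right.
have [_ _ step_id _ _] := step_profile R.
exists 0 => x /andP[rx _]; rewrite step_id; first by lra.
by move: rx; have := ler0n R r; rewrite -[r.+1]addn1 natrD; lra.
Qed.

Lemma relu_attains1 (R : realType) : attains_slope (@relu R) 1.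
Proof.
exists 0, (1 / 2); split; [lra..|]; exists 0 => x x0.
by rewrite /relu max_r; lra.
Qed.

Lemma step_attains1 (R : realType) : attains_slope (@step R) 1.
Proof.
have [_ _ step_id _ _] := step_profile R.
exists (1 / 4), (1 / 2); split; [lra..|]; exists 0 => x x0.
by rewrite step_id; lra.
Qed.

(** * Functions built from profiles *)

(* For a profile [phi], this is [phi u] for u <= 1/2 and [1 - phi (1 - u)] for
   u >= 1/2. *)
Definition symmetrize (R : realType) (phi : R -> R) (u : R) : R :=
  Num.min (1 / 2) (phi u) + 1 / 2 - Num.min (1 / 2) (phi (1 - u)).

(** With u = 2x and H the symmetrized profile, 2 H (u) - u is 0 at u = 0 and u = 2, so it closes up
    periodically, and it is 1 at u = 1, that is, at f = 1/2. *)
Definition profile_cut (R : realType) (phi : R -> R) : R -> R :=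
  periodize (fun x => 2 * symmetrize phi (2 * x) - 2 * x).

Section Cut.
Variables (R : realType) (phi : R -> R).
Hypothesis phiP : profile phi.
Local Notation H := (symmetrize phi).
Local Notation p := (profile_cut phi).
Local Notation f := (1 / 2 : R).

Let phi_homo : {homo phi : x y / x <= y}. Proof. by case: phiP. Qed.
Let phi_le0 (u : R) : u <= 0 -> phi u = 0. Proof. by case: phiP => _ h *; apply: h. Qed.
Let phi_id (u : R) : 1 / 4 <= u -> phi u = u. Proof. by case: phiP => _ _ h *; apply: h. Qed.
Let phi_ge (u : R) : u <= phi u. Proof. by case: phiP => _ _ _ h *; apply: h. Qed.
Let phi_sub (x y : R) : 0 <= x -> 0 <= y -> phi (x + y) <= phi x + phi y.
Proof. by case: phiP => _ _ _ _ h *; apply: h. Qed.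

Lemma symmetrize_le12 (u : R) : u <= 1 / 2 -> H u = phi u.
Proof.
move=> u2; rewrite /symmetrize (@phi_id (1 - u)); last by lra.
rewrite (@min_l _ _ _ (1 - u)); last by lra.
rewrite min_r ?addrK//.
by rewrite -[leRHS]phi_id; [apply: phi_homo|lra].
Qed.

Lemma symmetrizeN (u : R) : H (1 - u) = 1 - H u.
Proof. by rewrite /symmetrize subKr; lra. Qed.

Lemma symmetrize_ge12 (u : R) : 1 / 2 <= u -> H u = 1 - phi (1 - u).
Proof.
by move=> u2; rewrite -[X in H X](subKr 1) symmetrizeN symmetrize_le12//; lra.
Qed.

Lemma symmetrize_le0 (u : R) : u <= 0 -> H u = 0.
Proof. by move=> u0; rewrite symmetrize_le12 ?phi_le0//; lra. Qed.

Lemma symmetrize_ge1 (u : R) : 1 <= u -> H u = 1.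
Proof. by move=> u0; rewrite symmetrize_ge12 ?phi_le0 ?subr0//; lra. Qed.

Lemma symmetrize_homo : {homo H : x y / x <= y}.
Proof.
move=> x y xy; rewrite /symmetrize.
have : Num.min (1 / 2) (phi x) <= Num.min (1 / 2) (phi y).
  by rewrite le_min !ge_min lexx/= (phi_homo xy) orbT.
have : Num.min (1 / 2) (phi (1 - y)) <= Num.min (1 / 2) (phi (1 - x)).
  rewrite le_min !ge_min lexx/=; apply/orP; right; apply: phi_homo; lra.
lra.
Qed.

Let H_le1 (u : R) : H u <= 1.
Proof.
have [u1|u1] := lerP 1 u; first by rewrite symmetrize_ge1.
by rewrite -(@symmetrize_ge1 1)// symmetrize_homo// ltW.
Qed.

(** If x + y >= 1, then H (x + y) <= 1 = H x + H (1 - x) <= H x + H y. If x + y > 1/2, put z = 1 -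
    (x + y); the claim is H x + H y + H z >= 1. When all three are at most 1/2, it holds since [H]
    lies above the identity there; when x or y exceeds 1/2, reflecting it reduces the claim to
    subadditivity of [phi]. *)
Lemma symmetrize_sub (x y : R) : 0 <= x -> 0 <= y -> H (x + y) <= H x + H y.
Proof.
move=> x0 y0; have [xy|xy] := lerP 1 (x + y).
  have : H (1 - x) <= H y by apply: symmetrize_homo; lra.
  by rewrite symmetrizeN; have := H_le1 (x + y); lra.
have [xy2|xy2] := lerP (x + y) (1 / 2).
  by rewrite !symmetrize_le12; [exact: phi_sub|lra..].
pose z := 1 - (x + y).
have HxyE : H (x + y) = 1 - H z by rewrite symmetrizeN; lra.
have subz (s t : R) : 0 <= t -> s + t + z = 1 -> 1 / 2 < s -> 1 - H z <= H s + H t.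
  move=> t0 stz s2; have -> : s = 1 - (t + z) by lra.
  rewrite symmetrizeN !symmetrize_le12; try by rewrite /z in stz *; lra.
  by have := @phi_sub t z t0; rewrite /z; lra.
rewrite HxyE; have [x2|x2] := lerP x (1 / 2); last by apply: subz => //; rewrite /z; lra.
have [y2|y2] := lerP y (1 / 2); last first.
  by rewrite [leRHS]addrC; apply: subz => //; rewrite /z; lra.
have := phi_ge x; have := phi_ge y; have := phi_ge z.
by rewrite !symmetrize_le12//; rewrite /z; lra.
Qed.

Lemma cut_int (x y : R) : x - y \is a Num.int -> p x = p y.
Proof. exact: periodize_int. Qed.

(** The formula extends left of 0: [H] is 0 there and 1 on [1, 2], so the two branches of slope -2
    match under translation by 1. The range thus contains x and f - x for every x in [0, 1). *)
Lemma cutE (x : R) : - (1 / 2) <= x <= 1 -> p x = 2 * H (2 * x) - 2 * x.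
Proof.
move=> xI; have [x0|x0] := ltrP x 0.
  rewrite (@cut_int x (x + 1)); last by rewrite opprD addNKr rpredN1.
  rewrite /profile_cut periodize_itv01; last by lra.
  by rewrite (@symmetrize_ge1 (2 * (x + 1))) ?(@symmetrize_le0 (2 * x)); lra.
have [->|x1] := eqVneq x 1.
  rewrite (@cut_int 1 0) ?subr0//.
  rewrite /profile_cut periodize_itv01; last by lra.
  rewrite mulr0.
  by rewrite (@symmetrize_ge1 (2 * 1)) ?(@symmetrize_le0 0); lra.
by rewrite /profile_cut periodize_itv01//; move: x1; rewrite neq_lt; lra.
Qed.

Lemma cut0 : p 0 = 0.
Proof. by rewrite cutE ?mulr0 ?symmetrize_le0; lra. Qed.

Lemma cut_sym (x : R) : p x + p (f - x) = 1.
Proof.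
move: x; apply: periodic_ind => [x y xy|x x01].
  rewrite (cut_int xy) (@cut_int (f - x) (f - y)) //.
  by rewrite opprB addrC addrA subrK -opprB rpredN.
rewrite !cutE; try lra.
by rewrite (_ : 2 * (f - x) = 1 - 2 * x) ?symmetrizeN; lra.
Qed.

Let cut_ge0 (x : R) : 0 <= p x.
Proof.
move: x; apply: periodic_ind => [x y /cut_int -> //|x x01].
have [x2|x2] := lerP x (1 / 4).
  by rewrite cutE ?symmetrize_le12; [have := phi_ge (2 * x)| |]; lra.
have : H (1 / 2) <= H (2 * x) by apply: symmetrize_homo; lra.
rewrite cutE; last by lra.
have [x3|x3] := lerP x (1 / 2); first by rewrite symmetrize_le12 ?phi_id; lra.
by rewrite (@symmetrize_ge1 (2 * x)); lra.
Qed.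

Let cut_sub (x y : R) : p (x + y) <= p x + p y.
Proof.
move: x; apply: periodic_ind => [x z xz|x x01].
  by rewrite (cut_int xz) (@cut_int (x + y) (z + y)) ?addrKA// opprD addrACA subrr addr0.
move: y; apply: periodic_ind => [y z yz|y y01].
  by rewrite (cut_int yz) (@cut_int (x + y) (x + z)) ?addrKA// opprD addrACA subrr add0r.
have [xy|xy] := lerP (x + y) 1.
  rewrite !cutE; try lra.
  by have := @symmetrize_sub (2 * x) (2 * y); rewrite -mulrDr; lra.
(* When the sum wraps around, one summand is at least 1/2 and has H = 1; monotonicity handles the
   other. *)
rewrite (@cut_int (x + y) (x + y - 1)); last by rewrite subKr.
rewrite !cutE; try lra.
have [x2|x2] := lerP (1 / 2) x.
  have : H (2 * (x + y - 1)) <= H (2 * y) by apply: symmetrize_homo; lra.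
  by rewrite (@symmetrize_ge1 (2 * x)); lra.
have : H (2 * (x + y - 1)) <= H (2 * x) by apply: symmetrize_homo; lra.
by rewrite (@symmetrize_ge1 (2 * y)); lra.
Qed.

Lemma cut_valid : valid_function f p.
Proof.
apply: (valid_of_subadditive cut_ge0 cut0 cut_sub) => x xf.
by rewrite (cut_int xf); have := cut_sym 0; rewrite subr0 cut0; lra.
Qed.

Lemma cut_grid (N k : nat) : (0 < N)%N ->
  affine_cells (4 * N) (dyadic_slopes k) phi ->
  affine_on_grid (8 * N)%:R [set 4 * a - 2 | a in dyadic_slopes k] p.
Proof.
move=> N0 phiN; have NR : 0 < N%:R :> R by rewrite ltr0n.
have N4 : 0 < (4 * N)%:R :> R by rewrite ltr0n muln_gt0.
apply: periodic_grid => [|x y|r rN]; [by rewrite muln_gt0|exact: cut_int|].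
suff [a Sa [b Hab]] : exists2 a : R, dyadic_slopes k a & exists b,
    forall u, r%:R < u * (4 * N)%:R < r.+1%:R -> H u = a * u + b.
  exists (4 * a - 2); first by exists a.
  exists (2 * b) => x; rewrite (_ : (8 * N)%:R = 2 * (4 * N)%:R); last first.
    by rewrite -natrM; congr _%:R; lia.
  rewrite ltr_pdivrMr ?ltr_pdivlMr ?mulr_gt0// mulrA (mulrC x) => xr.
  have x01 : - (1 / 2) <= x <= 1.
    case/andP: xr => rx xr.
    have : 0 < 2 * x by rewrite -(ltr_pM2r N4) mul0r (le_lt_trans _ rx).
    have : 2 * x < 2.
      by rewrite -(ltr_pM2r N4) (lt_le_trans xr)// -natrM ler_nat; lia.
    lra.
  by rewrite cutE// Hab//; lra.
have [r2|r2] := ltnP r (2 * N).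
  have [a Sa [b phiab]] := phiN r; exists a => //; exists b => u uI.
  rewrite symmetrize_le12 ?phiab//.
    by rewrite ltr_pdivrMr ?ltr_pdivlMr.
  have : u * (4 * N)%:R <= 1 / 2 * (4 * N)%:R.
    case/andP: uI => _ ur; rewrite (le_trans (ltW ur))//.
    rewrite natrM mulrA (_ : 1 / 2 * 4%:R = 2%:R); last by lra.
    by rewrite -natrM ler_nat.
  by rewrite ler_pM2r.
have [r4|r4] := ltnP r (4 * N).
  (* The reflection u -> 1 - u maps cell r to cell 4N - r - 1 and preserves slopes of [H]. *)
  have [a Sa [b phiab]] := phiN (4 * N - r.+1)%N.
  exists a => //; exists (1 - a - b) => u /andP[ru ur].
  rewrite symmetrize_ge12 ?phiab; first by lra.
    rewrite (_ : (4 * N - r.+1).+1 = (4 * N - r)%N); last by lia.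
    rewrite ltr_pdivrMr// ltr_pdivlMr// !natrB//; last exact: ltnW.
    lra.
  rewrite -(ler_pM2r N4) (le_trans _ (ltW ru))//.
  rewrite natrM mulrA (_ : 1 / 2 * 4%:R = 2%:R); last by lra.
  by rewrite -natrM ler_nat.
exists 0; first by left.
exists 1 => u /andP[ru ur]; rewrite symmetrize_ge1 ?mul0r ?add0r//.
by rewrite -(ler_pM2r N4) mul1r (le_trans _ (ltW ru))// ler_nat.
Qed.

Lemma cut_attains (a : R) : attains_slope phi a ->
  exists c d, c < d /\ affine_between p (4 * a - 2) c d.
Proof.
move=> [c [d [c0 cd d2 [b phiab]]]]; exists (c / 2), (d / 2); split; first by lra.
exists (2 * b) => x xI; rewrite cutE ?symmetrize_le12 ?phiab; lra.
Qed.

(** The floor jumps at integers, but as [cutE] reaches left of 0, one formula with fixed [m] holds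
    on a neighbourhood of [x]. *)
Lemma cut_continuous : continuous phi -> continuous p.
Proof.
move=> phic x; pose m : R := (Num.floor x)%:~R.
have xm : 0 <= x - m < 1 := sub_floor_itv x.
pose g (y : R) := 2 * H (2 * (y - m)) - 2 * (y - m).
have gp (y : R) : m - 1 / 2 <= y <= m + 1 -> p y = g y.
  move=> yI; rewrite (@cut_int y (y - m)); first by rewrite cutE//; lra.
  by rewrite subKr; exact: intr_int.
have affc (a b : R) (u : R) : {for u, continuous (fun v : R => a * (v - b))}.
  by apply: cvgM; [exact: cvg_cst|apply: cvgB; [exact: cvg_id|exact: cvg_cst]].
have Hc u : {for u, continuous H}.
  apply: cvgB; first apply: cvgD; last 1 first.
  - apply: (@continuous_min _ _ (cst (1 / 2)) (phi \o (fun v => 1 - v))).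
      exact: cvg_cst.
    apply: continuous_comp; last exact: phic.
    by apply: cvgB; [exact: cvg_cst|exact: cvg_id].
  - apply: (@continuous_min _ _ (cst (1 / 2)) phi); [exact: cvg_cst|exact: phic].
  - exact: cvg_cst.
have gc : {for x, continuous g}.
  apply: cvgB; last exact: affc.
  apply: cvgM; first exact: cvg_cst.
  by apply: (@continuous_comp _ _ _ (fun y => 2 * (y - m)) H x); [exact: affc|exact: Hc].
rewrite /continuous_at gp; last by lra.
apply: (@cvg_trans _ (g y @[y --> x])); last exact: gc.
apply: near_eq_cvg; near=> y; apply/esym/gp/andP; split; apply/ltW; near: y.
  by apply: lt_nbhsr; lra.
by apply: lt_nbhsl; lra.
Unshelve. all: by end_near. Qed.

End Cut.

(* In the coordinate u = 2x, after adding u, every valid candidate vanishes on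
   [-1, 0]; translating by that flat piece forces it to be constant on the level
   sets, the piece of slope 1 pins its value at 1/4, and the part below 1/8 is
   the same problem for [phi]. *)
Lemma cut_graft_extreme (R : realType) (phi : R -> R) :
  profile phi -> rigid_profile phi -> extreme_function (1 / 2) (profile_cut (graft phi)).
Proof.
move=> phiP phiR; have graftP := graft_profile phiP.
have gge14 := graft_ge14 phiP; have gmid := graft_mid phiP.
have gle18 := graft_le18 phiP; have gcutE := cutE graftP.
apply: (extreme_of_rigid (cut_valid graftP) (cut0 graftP) (cut_sym graftP)).
  exact: cut_int.
move=> q q01 q0 qsym qint qadd.
pose H := symmetrize (graft phi).
have pE (u : R) : - 1 <= u <= 2 -> profile_cut (graft phi) (u / 2) = 2 * H u - u.
  move=> uI; rewrite gcutE//; last by lra.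
  by rewrite (_ : 2 * (u / 2) = u)//; lra.
have HE (u : R) : u <= 1 / 2 -> H u = graft phi u by move=> ?; apply: symmetrize_le12.
have HN (u : R) : H (1 - u) = 1 - H u := symmetrizeN _ u.
have H0 (u : R) : u <= 0 -> H u = 0 by move=> ?; apply: symmetrize_le0.
have Hid (u : R) : 1 / 4 <= u <= 3 / 4 -> H u = u.
  move=> uI; have [u2|u2] := lerP u (1 / 2); first by rewrite HE ?gge14; lra.
  by have := HN u; rewrite HE ?gge14; lra.
(* The candidate in the profile coordinate: [t] should equal [H], inverting q = 2 H - u. *)
pose t (u : R) := (q (u / 2) + u) / 2.
have tD (x y : R) : - 1 <= x <= 2 -> - 1 <= y <= 2 -> - 1 <= x + y <= 2 ->
    H (x + y) = H x + H y -> t (x + y) = t x + t y.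
  move=> xI yI xyI Hxy; rewrite /t.
  have := qadd (x / 2) (y / 2); rewrite -mulrDl !pE// => ->; first lra.
  by rewrite Hxy; lra.
have t0 : t 0 = 0 by rewrite /t mul0r q0; lra.
have tN u : t (1 - u) = 1 - t u.
  by rewrite /t; have := qsym (u / 2); rewrite -mulrBl; lra.
have t1 : t 1 = 1 by have := tN 0; rewrite subr0 t0; lra.
have tm1 : t (- 1) = 0.
  move: t1; rewrite /t (@qint (- 1 / 2) (1 / 2)); first lra.
  by rewrite (_ : _ - _ = - 1) ?rpredN1//; lra.
have tM (u : R) : - 1 <= u <= 1 -> `|t u| <= 1.
  by rewrite /t ler_norml; have := q01 (u / 2); lra.
(* [H] vanishes on [-1, 0], so [t] is additive there, hence linear, and periodicity gives t (-1) =
   0. *)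
have tneg (u : R) : - 1 <= u <= 0 -> t u = 0.
  move=> uI; have L0 : 0 < 1 :> R by [].
  have := Cauchy_bounded_linear L0 (g := fun d => t (- d)) (M := 1) _ _ (x := - u).
  rewrite opprK tm1 !mul0r => -> //; [|move=> x y x0 y0 xy|lra].
    by move=> x xI; apply: tM; lra.
  by rewrite opprD; apply: tD; [lra..|]; rewrite !H0; lra.
have tlev (x y : R) : 0 <= x <= 1 -> 0 <= y <= 1 -> H x = H y -> t x = t y.
  have main (v w : R) : 0 <= v <= 1 -> 0 <= w <= 1 -> v <= w -> H v = H w -> t v = t w.
    move=> vI wI vw Hvw; have := tD w (v - w).
    by rewrite subrKC (@tneg (v - w)) ?(@H0 (v - w)); lra.
  by move=> xI yI; have [xy|yx] := leP x y => Hxy; [|apply/esym]; apply: main => //; lra.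
(* Symmetry fixes t (1/2), additivity then fixes t (1/4), and the sums 1/4 + 1/4 to 3/4 stay where
   [H] is the identity. *)
have tid (u : R) : 1 / 4 <= u <= 1 / 2 -> t u = u.
  have t12 : t (1 / 2) = 1 / 2.
    by have := tN (1 / 2); rewrite (_ : 1 - 1 / 2 = 1 / 2); lra.
  have t14 : t (1 / 4) = 1 / 4.
    have := tD (1 / 4) (1 / 4); rewrite (_ : 1 / 4 + 1 / 4 = 1 / 2); last by lra.
    by rewrite !Hid; lra.
  move=> uI; have L0 : 0 < 1 / 4 :> R by lra.
  rewrite (@restricted_Cauchy_affine _ (1 / 4) _ 1 t L0); last by lra.
  - by rewrite (_ : 1 / 4 + 1 / 4 = 1 / 2) ?t12 ?t14; lra.
  - by move=> y yI; apply: tM; lra.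
  - by move=> y z y4 z4 yz; apply: tD; rewrite ?Hid; lra.
have tmid (u : R) : 1 / 8 <= u <= 1 / 4 -> t u = 1 / 4.
  move=> uI; rewrite (@tlev u (1 / 4)) ?tid ?HE ?gmid; lra.
have tlow (u : R) : 0 <= u <= 1 / 8 -> t u = graft phi u.
  move=> uI; have Hlow (v : R) : v <= 1 -> H (v / 8) = phi v / 4.
    by move=> v1; rewrite HE ?gle18 ?(mulrC 8) ?divfK; lra.
  rewrite gle18; last by lra.
  rewrite -(phiR (fun v => 4 * t (v / 8)) 4).
  - by rewrite /= (_ : 8 * u / 8 = u); lra.
  - by move=> v vI; rewrite normrM ger0_norm// ler_piMr// tM; lra.
  - move=> v w v0 w0 vw phivw; rewrite /= [(v + w) / 8]mulrDl tD; [lra..|].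
    by rewrite -mulrDl !Hlow; lra.
  - by move=> v w vI wI phivw; congr (4 * _); apply: tlev; rewrite ?Hlow ?phivw; lra.
  - by rewrite tmid; lra.
  - by lra.
have tH (u : R) : 0 <= u <= 1 -> t u = H u.
  have half (v : R) : 0 <= v <= 1 / 2 -> t v = H v.
    move=> vI; rewrite HE; last by lra.
    have [v8|v8] := lerP v (1 / 8); first by apply: tlow; lra.
    have [v4|v4] := lerP v (1 / 4); first by rewrite tmid ?gmid; lra.
    by rewrite tid ?gge14; lra.
  move=> uI; have [u2|u2] := lerP u (1 / 2); first by apply: half; lra.
  by have := half (1 - u); rewrite tN HN; lra.
apply: periodic_ind => [x y xy|x x01].
  by rewrite (qint _ _ xy) (cut_int _ xy).
have [x2|x2] := lerP x (1 / 2).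
  rewrite gcutE//; last by lra.
  by have := tH (2 * x); rewrite /t /H (_ : 2 * x / 2 = x); lra.
rewrite (@qint x (x - 1)) ?(@cut_int _ _ x (x - 1)) ?subKr//.
rewrite gcutE//; last by lra.
have := tneg (2 * (x - 1)); rewrite symmetrize_le0//; last by lra.
by rewrite /t (_ : 2 * (x - 1) / 2 = x - 1); lra.
Qed.

(** * Iterated grafts and the count of slopes *)

Definition good_profile (R : realType) (k : nat) (phi : R -> R) : Prop :=
  [/\ profile phi, rigid_profile phi,
      affine_cells (4 * 8 ^ k) (dyadic_slopes k) phi
    & forall i, (i <= k)%N -> attains_slope phi (2 ^+ i)].

Lemma relu_good (R : realType) : good_profile 0 (@relu R).
Proof.
split; [exact: relu_profile|exact: relu_rigid|exact: relu_cells|].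
by move=> [|//] _; exact: relu_attains1.
Qed.

Lemma step_good (R : realType) : good_profile 0 (@step R).
Proof.
split; [exact: step_profile|exact: step_rigid|exact: step_cells|].
by move=> [|//] _; exact: step_attains1.
Qed.

Lemma graft_good (R : realType) (k : nat) (phi : R -> R) :
  good_profile k phi -> good_profile k.+1 (graft phi).
Proof.
case=> phiP phiR phiN phiS; split.
- exact: graft_profile.
- exact: graft_rigid.
- rewrite expnS mulnCA; apply: graft_cells => //.
  by rewrite muln_gt0 expn_gt0.
- exact: graft_attains.
Qed.

Lemma cut_graft_slopes (R : realType) (k : nat) (phi : R -> R) :
  good_profile k phi ->
  piecewise_linear (profile_cut (graft phi)) /\ has_n_slopes k.+3 (profile_cut (graft phi)).
Proof.
move=> phiG; have [graftP _ graftN graftS] := graft_good phiG.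
have phiP : profile phi by case: phiG.
have N0 : (0 < 8 ^ k.+1)%N by rewrite expn_gt0.
have grid := cut_grid graftP N0 graftN.
have NR : 0 < (8 * 8 ^ k.+1)%:R :> R by rewrite ltr0n muln_gt0.
split; first exact: grid_piecewise_linear grid.
rewrite /has_n_slopes (slopes_grid NR grid); last first.
  move=> _ [a [->|[i ik ->]] <-]; apply: cut_attains => //.
    exact: graft_attains0.
  exact: graftS.
(* Enumerates 0, 1, 2, ..., 2^(k+1), which are k + 3 values. *)
pose s (n : nat) : R := if n is i.+1 then 2 ^+ i else 0.
have -> : [set 4 * a - 2 | a in dyadic_slopes k.+1] =
    [set 4 * s n - 2 | n in `I_k.+3].
  apply/seteqP; split => [_ [a [->|[i ik ->]] <-]|_ [[|i] /= ik <-]].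
  - by exists 0.
  - by exists i.+1.
  - by exists 0 => //; left.
  - by exists (2 ^+ i) => //; right; exists i.
apply: inj_card_eq => m n _ _ /= mn.
have {}mn : s m = s n by lra.
have exp_neq0 i : 2 ^+ i != 0 :> R by rewrite expf_neq0.
case: m n mn => [|m] [|n] //= /eqP.
- by rewrite eq_sym (negbTE (exp_neq0 n)).
- by rewrite (negbTE (exp_neq0 m)).
- by move/eqP/ieexprIn => ->//; lra.
Qed.

Lemma relu_continuous (R : realType) : continuous (@relu R).
Proof.
by move=> u; apply: (@continuous_max _ _ (cst 0) id); [exact: cvg_cst|exact: cvg_id].
Qed.

Lemma graft_continuous (R : realType) (phi : R -> R) :
  continuous phi -> continuous (graft phi).
Proof.
move=> phic u.
have c8 : {for u, continuous (fun v : R => phi (8 * v))}.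
  apply: (@continuous_comp R R R (fun v => 8 * v) phi); last exact: phic.
  by apply: cvgM; [exact: cvg_cst|exact: cvg_id].
apply: (@continuous_max _ _ id (fun v => Num.min (1 / 4) (phi (8 * v) / 4))).
  exact: cvg_id.
apply: (@continuous_min R R (cst (1 / 4)) (fun v => phi (8 * v) / 4) u).
  exact: cvg_cst.
by apply: cvgM; [exact: c8|exact: cvg_cst].
Qed.

Lemma iter_graft_relu (R : realType) (k : nat) :
  good_profile k (iter k (@graft R) (@relu R)) /\
  continuous (iter k (@graft R) (@relu R)).
Proof.
elim: k => [|k [ihg ihc]]; first by split; [exact: relu_good|exact: relu_continuous].
by split; [exact: graft_good|exact: graft_continuous].
Qed.

Lemma cut_graft_step_discontinuous (R : realType) : ~ continuous (profile_cut (graft (@step R))).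
Proof.
have stepP := step_profile R; have graftP := graft_profile stepP.
move=> /(_ 0); rewrite /continuous_at cut0// => c0.
have pc : profile_cut (graft (@step R)) x @[x --> 0^'+] --> 0.
  exact: cvg_at_right_filter.
(* For 0 < x < 1/64 the function is 1/8 - 2x, which exceeds 1/16. *)
suff : 1 / 16 <= 0 :> R by lra.
apply: (cvgr_to_ge pc); near=> x.
have x0 : 0 < x by near: x; exact: nbhs_right_gt.
have x1 : x < 1 / 64 by near: x; apply: nbhs_right_lt; lra.
rewrite (cutE graftP); last by lra.
rewrite (symmetrize_le12 graftP); last by lra.
rewrite (graft_le18 stepP); last by lra.
by rewrite /step ifN -?ltNge ?max_r; lra.
Unshelve. all: by end_near. Qed.

Lemma inv_not_int (R : realType) (m : nat) : (1 < m)%N ->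
  (1 / m%:R : R) \isn't a Num.int.
Proof.
move=> m1; have mR : 1 < m%:R :> R by rewrite ltr1n.
apply/negP => /intrP[n nE].
have n0 : 0 < n%:~R :> R by rewrite -nE divr_gt0// (lt_trans _ mR).
have n1 : n%:~R < 1 :> R by rewrite -nE ltr_pdivrMr ?mul1r// (lt_trans _ mR).
by move: n0 n1; rewrite ltr0z ltrz1; lia.
Qed.

Theorem proposition2p14 (R : realType) :
  [/\ forall s : nat, s \in [:: 5; 6; 7; 28]%N ->
        exists (f : R) (p : R -> R),
          [/\ f \isn't a Num.int, extreme_function f p, piecewise_linear p,
              continuous p & has_n_slopes s p],
      exists (f : R) (p : R -> R),
        [/\ f \isn't a Num.int, extreme_function f p, piecewise_linear p,
            ~ continuous p & has_n_slopes 3 p]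
    & exists (f : R) (p : R -> R),
        [/\ f \isn't a Num.int, extreme_function f p, piecewise_linear p,
            ~ continuous_from_left p 0 & ~ continuous_from_right p 0]].
Proof.
split.
(* With k + 1 grafts of [relu] the function has k + 3 slopes. *)
- move=> s sI; have [k ->] : exists k, s = k.+3.
    by exists (s - 3)%N; move: sI; rewrite !inE; lia.
  have [kg kc] := iter_graft_relu R k; have [kP kR _ _] := kg.
  have [pl ns] := cut_graft_slopes kg.
  exists (1 / 2), (profile_cut (graft (iter k (@graft R) (@relu R)))); split => //.
  + exact: inv_not_int.
  + exact: cut_graft_extreme.
  + by apply: cut_continuous; [exact: graft_profile|exact: graft_continuous].
(* One graft of [step] has slopes 0, 1 and 2, which become -2, 2 and 6. *)
- have [pl ns] := cut_graft_slopes (step_good R).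
  exists (1 / 2), (profile_cut (graft (@step R))); split => //.
  + exact: inv_not_int.
  + by apply: cut_graft_extreme; [exact: step_profile|exact: step_rigid].
  + exact: cut_graft_step_discontinuous.
- exists (1 / 3), (@two_sided R); split.
  + exact: inv_not_int.
  + exact: two_sided_extreme.
  + exact: two_sided_piecewise_linear.
  + exact: two_sided_not_left_continuous.
  + exact: two_sided_not_right_continuous.
Qed.
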